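(* Let $d,e>1$ be integers, let $\lambda$ be an $e$-regular partition which is $d$-balanced (with respect to $e$), and let $i\in\{0,1,\dots,e-1\}$. Then $\sigma_i(\lambda)$ is also $d$-balanced (with respect to $e$).
   Context: A partition $\lambda=(\lambda_1\ge\lambda_2\ge\dots\ge\lambda_\ell>0)$ has Young diagram $[\lambda]=\{(r,c):1\le r\le \ell,\ 1\le c\le\lambda_r\}$; $\lambda'$ denotes the conjugate partition. It is $e$-regular if no part is repeated $e$ or more times. For $(r,c)\in[\lambda]$, the hook at $(r,c)$ consists of $(r,c)$, the nodes strictly to its right in row $r$ and the nodes strictly below it in column $c$. Its arm length is $a_{rc}(\lambda)=\lambda_r-c$, its leg length is $\lambda'_c-r$, and its hook length is $h_{rc}(\lambda)=a_{rc}(\lambda)+(\lambda'_c-r)+1$. The partition $\lambda$ is $d$-balanced (with respect to $e$) if $d\mid a_{rc}(\lambda)$ for every node $(r,c)\in[\lambda]$ with $e\mid h_{rc}(\lambda)$. Affine reflections. A node is any pair $(r,c)$ of positive integers; its $e$-residue is the remainder of $c-r$ modulo $e$, in $\{0,\dots,e-1\}$. Rows are drawn with row $1$ at the top. A node of $e$-residue $i$ is $i$-removable (respectively $i$-addable) for $\lambda$ if removing it from (respectively adding it to) $[\lambda]$ gives the Young diagram of a partition. The $i$-signature of $\lambda$ is the sequence of signs obtained by labelling all $i$-addable nodes by $+$ and all $i$-removable nodes by $-$ and reading them along the rim from bottom left to upper right. The reduced $i$-signature is obtained by successively deleting neighbouring pairs $-+$ until none remain; it has the form $+\cdots+-\cdots-$.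 Let $\varphi_i(\lambda)$ and $\varepsilon_i(\lambda)$ be the numbers of $+$'s and $-$'s, respectively, in the reduced $i$-signature. If $\varepsilon_i(\lambda)>0$, let $\tilde e_i(\lambda)$ be $\lambda$ with the removable node corresponding to the leftmost $-$ of the reduced $i$-signature removed. If $\varphi_i(\lambda)>0$, let $\tilde f_i(\lambda)$ be $\lambda$ with the addable node corresponding to the rightmost $+$ of the reduced $i$-signature added. For an $e$-regular partition $\lambda$, the affine $i$-reflection is $$\sigma_i(\lambda)=\begin{cases}\tilde f_i^{\,\varphi_i(\lambda)-\varepsilon_i(\lambda)}(\lambda)&\text{if }\varepsilon_i(\lambda)<\varphi_i(\lambda),\\ \tilde e_i^{\,\varepsilon_i(\lambda)-\varphi_i(\lambda)}(\lambda)&\text{if }\varepsilon_i(\lambda)>\varphi_i(\lambda),\\ \lambda&\text{if }\varepsilon_i(\lambda)=\varphi_i(\lambda).\end{cases}$$ *)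

(* Defs.v *)
From HB Require Import structures.
From mathcomp Require Import all_boot ssralg ssrint intdiv.

Set Implicit Arguments.
Unset Strict Implicit.
Unset Printing Implicit Defensive.

Definition is_part (s : seq nat) : bool := sorted geq s && (0 \notin s).

Record intpart := Intpart { parts :> seq nat; _ : is_part parts }.
HB.instance Definition _ := [isSub for parts].
HB.instance Definition _ := [Equality of intpart by <:].

(* Nodes (r, c) are numbered from 1; rowlen r is 0 below the diagram. *)
Definition node := (nat * nat)%type.

Definition rowlen (la : intpart) (r : nat) : nat := nth 0 la r.-1.

(* The part of index c in the conjugate partition, for c > 0. *)
Definition collen (la : intpart) (c : nat) : nat := count (leq c) la.

Definition young (la : intpart) : pred node :=
  [pred A : node | [&& 0 < A.1, 0 < A.2 & A.2 <= rowlen la A.1]].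

Definition arm (la : intpart) (A : node) : nat := rowlen la A.1 - A.2.
Definition leg (la : intpart) (A : node) : nat := collen la A.2 - A.1.
Definition hook_length (la : intpart) (A : node) : nat :=
  arm la A + leg la A + 1.

Definition e_regular (e : nat) (la : intpart) : Prop :=
  forall x : nat, x \in parts la -> count_mem x la < e.

Definition d_balanced (d e : nat) (la : intpart) : Prop :=
  forall A : node, A \in young la -> e %| hook_length la A -> d %| arm la A.

Definition residue (e : nat) (A : node) : int :=
  ((Posz A.2 - Posz A.1)%R %% Posz e)%Z.

(* addableP and removableP below show that these say that adding (removing) the
   node yields a Young diagram; add_node and rem_node compute the corresponding
   partition (young_add, young_rem) and are used only at such nodes. *)
Definition addable (la : intpart) (A : node) : bool :=
  [&& 0 < A.1, A.2 == (rowlen la A.1).+1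
    & (A.1 == 1) || (rowlen la A.1 < rowlen la A.1.-1)].

Definition removable (la : intpart) (A : node) : bool :=
  [&& 0 < A.1, 0 < A.2, A.2 == rowlen la A.1 & rowlen la A.1.+1 < rowlen la A.1].

Definition add_node (la : intpart) (A : node) : intpart :=
  insubd la (incr_nth la A.1.-1).

Definition rem_node (la : intpart) (A : node) : intpart :=
  insubd la [seq x <- set_nth 0 la A.1.-1 (rowlen la A.1).-1 | 0 < x].

(* Signs are booleans, true for + and false for -; each sign carries its node. *)
Definition signature (e i : nat) (la : intpart) : seq (bool * node) :=
  flatten [seq
    [seq (false, A) | A <- [:: (r, rowlen la r)]
                    & removable la A && (residue e A == Posz i)] ++
    [seq (true, A) | A <- [:: (r, (rowlen la r).+1)]
                   & addable la A && (residue e A == Posz i)]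
  | r <- rev (iota 1 (size la).+1)].

(* Deletes the leftmost neighbouring pair -+, if there is one. *)
Fixpoint cancel_pair (s : seq (bool * node)) : seq (bool * node) :=
  match s with
  | (false, _) :: (true, _) :: s' => s'
  | x :: s' => x :: cancel_pair s'
  | [::] => [::]
  end.

(* Each effective deletion shortens the sequence, so size s steps exhaust all
   the pairs -+ (cancel_reduce). *)
Definition reduce (s : seq (bool * node)) : seq (bool * node) :=
  iter (size s) cancel_pair s.

Definition reduced_signature (e i : nat) (la : intpart) :=
  reduce (signature e i la).

Definition plus_nodes (e i : nat) (la : intpart) : seq node :=
  [seq x.2 | x <- reduced_signature e i la & x.1].
Definition minus_nodes (e i : nat) (la : intpart) : seq node :=
  [seq x.2 | x <- reduced_signature e i la & ~~ x.1].

Definition varphi (e i : nat) (la : intpart) : nat :=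
  size (plus_nodes e i la).
Definition vareps (e i : nat) (la : intpart) : nat :=
  size (minus_nodes e i la).

(* Outside their domain of definition the two operators return la. *)
Definition e_tilde (e i : nat) (la : intpart) : intpart :=
  if minus_nodes e i la is A :: _ then rem_node la A else la.
Definition f_tilde (e i : nat) (la : intpart) : intpart :=
  if rev (plus_nodes e i la) is A :: _ then add_node la A else la.

Definition sigma (e i : nat) (la : intpart) : intpart :=
  if vareps e i la < varphi e i la
  then iter (varphi e i la - vareps e i la) (f_tilde e i) la
  else if varphi e i la < vareps e i la
  then iter (vareps e i la - varphi e i la) (e_tilde e i) la
  else la.

Lemma is_partP (s : seq nat) :
  reflect ((forall k, nth 0 s k.+1 <= nth 0 s k) /\
           (forall k, k < size s -> 0 < nth 0 s k)) (is_part s).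
Proof.
apply: (iffP andP) => [[/(sortedP 0) srt n0]|[dec pos]]; split.
- move=> k; case: (ltnP k.+1 (size s)) => [/srt //|le].
  by rewrite nth_default.
- move=> k lt; rewrite lt0n; apply: contra n0 => /eqP <-; exact: mem_nth.
- by apply/(sortedP 0) => k _; apply: dec.
- by apply/negP => /(nthP 0) [k /pos + eq0]; rewrite eq0.
Qed.

Lemma row_leS (la : intpart) r : 0 < r -> rowlen la r.+1 <= rowlen la r.
Proof. by case: r => // r _; case: la => s ps; have [+ _] := is_partP _ ps; apply. Qed.

Lemma is_part_incr (la : intpart) A :
  addable la A -> is_part (incr_nth la A.1.-1).
Proof.
case: la A => s ps [[|r] c] //; rewrite /addable /rowlen /= => /andP [_ lt].
have [dec pos] := is_partP _ ps.
apply/is_partP; split => k; rewrite !nth_incr_nth.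
  case: (r =P k.+1) lt => [-> /= |_ _]; last by rewrite (leq_trans (dec k)) ?leq_addl.
  by move=> lt; rewrite add1n (leq_trans lt) ?leq_addl.
have [//|ne] := eqVneq r k; rewrite size_incr_nth add0n.
case: (ltnP r (size s)) => [_ /pos //|le]; rewrite ltnS leq_eqVlt eq_sym (negbTE ne) /=.
case: r le lt ne => [//|r] le /= lt _; rewrite ltnS => kr.
have /leq_trans lt' : 0 < nth 0 s r by exact: leq_trans lt.
apply: lt'; elim: r kr {lt le} => [|r IH]; first by rewrite leqn0 => /eqP ->.
by rewrite leq_eqVlt => /predU1P [-> //|/IH]; apply: leq_trans.
Qed.

Lemma row_add (la : intpart) A r : addable la A -> 0 < r ->
  rowlen (add_node la A) r = (A.1 == r) + rowlen la r.
Proof.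
move=> aA; rewrite /rowlen /add_node insubdK; last exact: is_part_incr.
rewrite nth_incr_nth; case/and3P: aA; case: A => [[|r0] c] //= _ _ _.
by case: r.
Qed.

Lemma young_add (la : intpart) A : addable la A ->
  young (add_node la A) =i [predU1 A & young la].
Proof.
move=> aA [r c]; rewrite !inE /=; case: r => [|r].
  by case: A aA => [[|r0] c0] //; rewrite /addable /= xpair_eqE.
rewrite row_add //; case: A aA => [r0 c0] /and3P [/= _ /eqP -> _].
rewrite xpair_eqE /= eq_sym; case: eqP => [->|_] //=.
by rewrite add1n [c <= _.+1]leq_eqVlt ltnS; case: eqP => [->|].
Qed.

Lemma young_row (la : intpart) r c :
  ((r, c) \in young la) = [&& 0 < r, 0 < c & c <= rowlen la r].
Proof. by []. Qed.

Lemma addableP (la : intpart) (A : node) :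
  reflect (A \notin young la /\
           exists mu : intpart, young mu =i [predU1 A & young la])
          (addable la A).
Proof.
apply: (iffP idP) => [aA|[nA [mu ymu]]].
  split; last by exists (add_node la A); exact: young_add.
  by case/and3P: aA => r0 /eqP eA _; rewrite inE /= r0 eA ltnn !andbF.
have: A \in young mu by rewrite ymu inE eqxx.
case: A nA ymu => r c nA ymu; rewrite young_row => /and3P [r0 c0 cmu].
rewrite /addable /= r0 /=; move: nA; rewrite young_row r0 c0 /= -ltnNge => lt.
apply/andP; split.
  rewrite eqn_leq lt andbT; case: c c0 cmu ymu lt => [//|[//|c]] _ cmu ymu lt.
  have: (r, c.+1) \in young mu by rewrite young_row r0 /= ltnW.
  rewrite ymu inE /= xpair_eqE eqxx /= [c.+1 == _]eqn_leq ltnn andbF /= => /and3P [_ _].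
  by rewrite ltnS.
case: r r0 cmu ymu lt => [//|[//|r]] _ cmu ymu lt /=.
have: (r.+1, c) \in young mu by rewrite young_row c0 (leq_trans cmu) ?row_leS.
rewrite ymu inE /= xpair_eqE [r.+1 == _]eqn_leq ltnn andbF /= => /and3P [_ _].
exact: leq_trans.
Qed.

Lemma nth_filter_pos (s : seq nat) k :
  (forall k, nth 0 s k.+1 <= nth 0 s k) ->
  nth 0 [seq x <- s | 0 < x] k = nth 0 s k.
Proof.
elim: s k => [|x s IH] k dec //=; case: posnP => [x0|x0].
  have z j : nth 0 (x :: s) j = 0.
    by elim: j => [|j IHj] //; apply/eqP; rewrite -leqn0; have := dec j; rewrite IHj.
  rewrite IH => [|j]; last exact: (dec j.+1).
  by rewrite -[LHS]/(nth 0 (x :: s) k.+1) !z.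
by case: k => //= k; apply: IH => j; exact: (dec j.+1).
Qed.

Lemma rem_dec (la : intpart) A : removable la A ->
  forall k, let s := set_nth 0 la A.1.-1 (rowlen la A.1).-1 in
  nth 0 s k.+1 <= nth 0 s k.
Proof.
case: la A => s ps [[|r] c] //; rewrite /removable /rowlen /= => /and3P [_ _ lt] k.
have [dec pos] := is_partP _ ps.
rewrite !nth_set_nth /=; have [e1|_] := eqVneq k.+1 r.
  rewrite -e1 -[k == _]negbK neq_ltn ltnSn /= (leq_trans _ (dec k)) //.
  exact: leq_pred.
have [->|_] := eqVneq k r; last exact: dec.
by rewrite -ltnS (leq_trans lt) // leqSpred.
Qed.

Lemma is_part_rem (la : intpart) A : removable la A ->
  is_part [seq x <- set_nth 0 la A.1.-1 (rowlen la A.1).-1 | 0 < x].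
Proof.
move=> /rem_dec dec; apply/is_partP; split=> k.
  by rewrite !nth_filter_pos; first exact: dec; exact: dec.
by move=> lt; have := mem_nth 0 lt; rewrite mem_filter => /andP [].
Qed.

Lemma row_rem (la : intpart) A r : removable la A -> 0 < r ->
  rowlen (rem_node la A) r = rowlen la r - (A.1 == r).
Proof.
move=> rA r0; rewrite /rowlen /rem_node insubdK; last exact: is_part_rem.
rewrite nth_filter_pos; last exact: rem_dec.
rewrite nth_set_nth /=; case/and3P: rA; case: A => [[|r1] c] //= _ _ _.
case: r r0 => //= r _; rewrite eqSS [r1 == r]eq_sym.
by case: eqP => [->|_]; rewrite ?subn1 ?subn0.
Qed.

Lemma young_rem (la : intpart) A : removable la A ->
  young (rem_node la A) =i [predD1 young la & A].
Proof.
move=> rA [r c]; rewrite !inE /=; case: r => [|r]; first by rewrite andbF.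
rewrite row_rem //; case: A rA => [r0 c0] /and4P [/= _ p /eqP e0 _].
move: p; rewrite {}e0 xpair_eqE /= eq_sym.
have [->|_] := eqVneq r0 r.+1; rewrite ?subn0 // subn1 => p.
have -> : (c <= (rowlen la r.+1).-1) = (c < rowlen la r.+1).
  by case: (rowlen la r.+1) p.
by rewrite [c < _]ltn_neqAle andbCA.
Qed.

Lemma removableP (la : intpart) (A : node) :
  reflect (A \in young la /\
           exists mu : intpart, young mu =i [predD1 young la & A])
          (removable la A).
Proof.
apply: (iffP idP) => [rA|[yA [mu ymu]]].
  split; last by exists (rem_node la A); exact: young_rem.
  by case/and4P: rA => r0 c0 /eqP eA _; rewrite inE /= r0 c0 -eA leqnn.
have: A \notin young mu by rewrite ymu inE /= eqxx.
case: A yA ymu => r c; rewrite !young_row => /and3P [r0 c0 cla] ymu.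
rewrite r0 c0 /= -ltnNge => ltc; rewrite /removable /= r0 c0 /=.
have ec : c == rowlen la r.
  rewrite eqn_leq cla leqNgt; apply/negP => lt.
  have: (r, c.+1) \in young mu.
    by rewrite ymu !inE /= xpair_eqE r0 lt [c.+1 == c]eqn_leq ltnn andbF.
  by rewrite young_row => /and3P [_ _ /ltnW]; rewrite leqNgt ltc.
rewrite ec /= -(eqP ec) ltnNge; apply/negP => le.
have: (r.+1, c) \in young mu.
  by rewrite ymu !inE /= xpair_eqE c0 le [r.+1 == r]eqn_leq ltnn.
by rewrite young_row => /and3P [_ _ /leq_trans/(_ (row_leS mu r0))]; rewrite leqNgt ltc.
Qed.

Lemma cancel_pairVsize s :
  cancel_pair s = s \/ size (cancel_pair s) < size s.
Proof.
elim: s => [|[b A] s IH] /=; first by left.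
have g : (b, A) :: cancel_pair s = (b, A) :: s \/
    size ((b, A) :: cancel_pair s) < (size s).+1.
  by case: IH => [->|lt]; [left|right].
by case: b g => //; case: s {IH} => [|[[] B] s] //= _; right; rewrite ltnS leqnSn.
Qed.

Lemma cancel_reduce s : cancel_pair (reduce s) = reduce s.
Proof.
rewrite /reduce; have: size s <= size s by [].
move: {2 3 4}(size s) => n; elim: n s => [|n IH] s; first by case: s.
rewrite iterSr; case: (cancel_pairVsize s) => [e0 _|lt le].
  rewrite e0; have -> : iter n cancel_pair s = s by elim: n {IH} => //= n ->.
  by [].
by apply: IH; rewrite -ltnS (leq_trans lt).
Qed.

(* Main.v *)
(* Read the rim of a partition as a sequence of beads (vertical steps) and gaps
   (horizontal steps) indexed by content. A hook is a gap z below a bead z', its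
   length is z' - z, and its arm length is the difference of the columns in
   which the two steps end; so being d-balanced means that the columns of a gap
   and of a bead above it in the same class mod e are congruent mod d.
   Passing to sigma_i only exchanges a bead and a gap at certain pairs of
   positions (z - 1, z) with z = i mod e. Comparing two such pairs, only the
   case where both carry a sign of the i-signature matters, and there the
   condition on two nodes of columns c (first) and c' is: c + 1 = c' mod d for
   signs - +, c = c' mod d for signs + -. The nodes deleted from the signature
   form bracket words, each of which lies entirely on one side of any surviving
   sign, and contains with every node a partner of opposite sign; this makes the
   conditions between surviving and deleted nodes independent of the surviving
   sign, and the conditions between surviving nodes of both signs say that all
   their columns are congruent. *)
Require Import Defs.
From mathcomp Require Import all_boot all_order all_algebra zify.

Set Implicit Arguments.
Unset Strict Implicit.
Unset Printing Implicit Defensive.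

(** * Bracket words and the reduced signature *)

Section Words.
Implicit Types (x y : bool * node) (s t D : seq (bool * node)) (A : node).

(** One step of a one-pass reduction from the right, which replaces the iteration of [cancel_pair]
    by a structural recursion. *)
Definition push x s :=
  if s is (true, _) :: s' then if x.1 then x :: s else s' else x :: s.

Lemma push_plus A s : push (true, A) s = (true, A) :: s.
Proof. by case: s => [|[[] B] s]. Qed.

Lemma foldr_push_cancel s : foldr push [::] (cancel_pair s) = foldr push [::] s.
Proof.
elim: s => [|[[] A] s IH] //=; first by rewrite IH.
by case: s IH => [|[[] B] s] //= IH; rewrite ?push_plus ?IH.
Qed.

Lemma foldr_push_fix s : cancel_pair s = s -> foldr push [::] s = s.
Proof.
elim: s => [|[[] A] s IH] //=; first by case=> /IH ->; rewrite push_plus.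
case: s IH => [|[[] B] s] // IH; last by case=> /IH ->.
by move=> /(congr1 size) /=; lia.
Qed.

Lemma reduceE s : reduce s = foldr push [::] s.
Proof.
rewrite -[LHS]foldr_push_fix ?cancel_reduce //.
by rewrite /reduce; elim: (size s) => //= n <-; rewrite foldr_push_cancel.
Qed.

(** The words that cancel completely, with - as opening and + as closing bracket. *)
Inductive dyck : seq (bool * node) -> Prop :=
| dyck_nil : dyck [::]
| dyck_cons A B D E : dyck D -> dyck E ->
    dyck ((false, A) :: D ++ (true, B) :: E).

Lemma dyck_cat D E : dyck D -> dyck E -> dyck (D ++ E).
Proof.
move=> dD dE; elim: dD => {D} [//|A B D E' dD _ _ IH] /=.
by rewrite -catA; apply: dyck_cons.
Qed.

Lemma foldr_push_dyck D s : dyck D -> foldr push [::] (D ++ s) = foldr push [::] s.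
Proof.
move=> dD; elim: dD s => {D} [//|A B D E _ IHD _ IHE] s /=.
by rewrite -catA IHD /= IHE push_plus.
Qed.

(* [fill n sk E] is the word D1 A1 D2 A2 ... Dk Ak E for
   sk = [:: (D1, A1); ...; (Dk, Ak)], where the signs of the Aj are + for the
   first n of them and - for the others. *)
Fixpoint fill n (sk : seq (seq (bool * node) * node)) E :=
  if sk is (D, A) :: sk' then D ++ (0 < n, A) :: fill n.-1 sk' E else E.

Fixpoint signs n (w : seq node) : seq (bool * node) :=
  if w is A :: w' then (0 < n, A) :: signs n.-1 w' else [::].

Fixpoint dycks (sk : seq (seq (bool * node) * node)) : Prop :=
  if sk is (D, _) :: sk' then dyck D /\ dycks sk' else True.

(** Built from the right: a new + survives, a new - survives if no + does; otherwise it cancels the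
    first surviving +, and the bracket word so formed joins the next block, or [E]. *)
Lemma fill_exists s : exists n sk E,
  [/\ s = fill n sk E, dycks sk, dyck E & n <= size sk].
Proof.
elim: s => [|[b A] s [n [sk [E [-> dsk dE le]]]]].
  by exists 0, [::], [::]; split=> //; constructor.
case: b.
  exists n.+1, (([::], A) :: sk), E; split=> //; split=> //; constructor.
case: n le => [|n] le.
  by exists 0, (([::], A) :: sk), E; split=> //; split=> //; constructor.
case: sk dsk le => [|[D B] sk] // [dD dsk] /= le.
case: sk dsk le => [|[D' B'] sk] /= dsk le.
  exists 0, [::], ((false, A) :: D ++ (true, B) :: E); split=> //.
  by constructor.
case: dsk => dD' dsk.
exists n, (((false, A) :: D ++ (true, B) :: D', B') :: sk), E; split=> //=.
  by rewrite -catA.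
by split=> //; constructor.
Qed.

Lemma reduce_fill n sk E : dycks sk -> dyck E ->
  reduce (fill n sk E) = signs n (unzip2 sk).
Proof.
rewrite reduceE => + dE; elim: sk n => [|[D A] sk IH] n /=.
  by rewrite -[E]cats0 foldr_push_dyck.
case=> dD /IH{}IH; rewrite foldr_push_dyck //= IH.
by case: sk {IH} => [|[D' B] sk] //=; case: n => [|[|n]].
Qed.

Lemma signs_plus n w : [seq x.2 | x <- signs n w & x.1] = take n w.
Proof. by elim: w n => [|A w IH] [|n] //=; rewrite IH // take0. Qed.

Lemma signs_minus n w : [seq x.2 | x <- signs n w & ~~ x.1] = drop n w.
Proof. by elim: w n => [|A w IH] [|n] //=; rewrite IH // drop0. Qed.

Definition set_sign b A x := if x.2 == A then (b, A) else x.

Lemma set_sign_id b A s : A \notin unzip2 s -> map (set_sign b A) s = s.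
Proof.
elim: s => [|x s IH] //=; rewrite inE negb_or => /andP [ne /IH ->].
by rewrite /set_sign eq_sym (negbTE ne).
Qed.

Lemma mem_fill_node n sk E A : A \in unzip2 sk -> A \in unzip2 (fill n sk E).
Proof.
elim: sk n => [|[D B] sk IH] n //=; rewrite /unzip2 map_cat mem_cat !inE /=.
by case/predU1P=> [->|/(IH n.-1) h]; rewrite ?eqxx ?h !orbT.
Qed.

(** Distinct nodes make [set_sign] touch a single letter. The thresholds [n] and [m] are compared
    only away from [k], so the boundary between + and - can move in either direction. *)
Lemma set_sign_fill (b : bool) n m k sk E A0 :
    uniq (unzip2 (fill n sk E)) -> k < size sk ->
    (forall j, j != k -> (j < m) = (j < n)) -> (k < m) = b ->
  map (set_sign b (nth A0 (unzip2 sk) k)) (fill n sk E) = fill m sk E.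
Proof.
elim: sk n m k => [|[D A] sk IH] n m k //=.
rewrite {1}/unzip2 map_cat cat_uniq /= => /and4P [_ ND NA U] lt nm mb.
rewrite map_cat /=; case: k lt nm mb => [_ nm mb|k lt nm mb].
  rewrite /= !set_sign_id //; last first.
    by apply: contra ND => ND; rewrite ND.
  rewrite /set_sign /= eqxx -mb; congr (_ ++ _ :: _).
  elim: sk n m nm {IH ND NA U mb} => [|[D' B] sk IH] n m nm //=.
  have -> : (0 < n.-1) = (0 < m.-1) by have := nm 1 isT; case: n m {nm} => [|[|n]] [|[|m]].
  congr (_ ++ _ :: _); apply: IH => j j0.
  by have := nm j.+1 isT; case: n m {nm} => [|[|n]] [|[|m]] //=; rewrite ?ltn0 //; case: j j0.
have mem : nth A0 (unzip2 sk) k \in unzip2 sk by rewrite mem_nth // size_map.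
have memf := mem_fill_node n.-1 E mem.
rewrite set_sign_id; last first.
  apply: contra ND => inD; rewrite /= -/(unzip2 _); apply/orP; right.
  by apply/hasP; exists (nth A0 (unzip2 sk) k).
rewrite (IH n.-1 m.-1) //; first last.
- by rewrite -mb; case: m {nm mb}.
- by move=> j /= jk; have := nm j.+1 jk; case: n m {nm mb U NA ND memf} => [|n] [|m].
rewrite /set_sign /=; case: eqP => [eA|_]; first by rewrite eA memf in NA.
by rewrite (nm 0 isT).
Qed.

End Words.

(** * The condition on pairs of signs *)

Section SignCondition.
Variable d : nat.
Implicit Types (x y : bool * node) (s D : seq (bool * node)).

(* For x before y in a signature. *)
Definition sign_ok x y :=
  (x.1 != y.1) ==> (x.2.2 + ~~ x.1 == y.2.2 %[mod d]).

(** The partner is the matching bracket; the shift by [~~ x.1] makes the condition on a matched pair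
    symmetric in its two letters. *)
Lemma dyck_partner D x : dyck D -> pairwise sign_ok D -> x \in D ->
  exists2 y, y \in D & (y.1 = ~~ x.1) /\ (x.2.2 + ~~ x.1 == y.2.2 + ~~ y.1 %[mod d]).
Proof.
move=> dD; elim: dD => {D} [//|A B D E dD IHD dE IHE].
rewrite pairwise_cons pairwise_cat all_cat /= => /andP [/andP [_ /andP [+ _]]].
rewrite /sign_ok /= addn1 => AB /and4P [_ pD _ pE].
rewrite inE mem_cat inE => /or4P [/eqP->|xD|/eqP->|xE].
- by exists (true, B); rewrite ?inE ?mem_cat ?inE ?eqxx ?orbT //= addn0 addn1.
- by have [y yD hy] := IHD pD xD; exists y; rewrite // inE mem_cat yD orbT.
- exists (false, A); rewrite ?inE ?eqxx //= addn0 addn1; split=> //.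
  by rewrite eq_sym.
have [y yE hy] := IHE pE xE; exists y => //.
by rewrite !(inE, mem_cat) yE !orbT.
Qed.


Lemma eqSn_mod a b : (a.+1 == b.+1 %[mod d]) = (a == b %[mod d]).
Proof. by rewrite -addn1 -[b.+1]addn1 eqn_modDr. Qed.

(** Only letters of the opposite sign constrain [(b, A)]; after a sign change, the constraint from a
    letter of [D] is the one that its partner gave before. *)
Lemma sign_ok_dyckr b b' A D : dyck D -> pairwise sign_ok D ->
  all (sign_ok (b, A)) D -> all (sign_ok (b', A)) D.
Proof.
move=> dD pD /allP h; apply/allP=> -[s [r c]] xD.
have [[s' [r' c']] yD /= [es exy]] := dyck_partner dD pD xD.
move: exy yD; rewrite {s'}es => exy yD.
have := h _ xD; have := h _ yD; rewrite /sign_ok /=.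
case: s b b' exy {h xD yD} => [] [] [] //=; rewrite ?addn0 ?addn1 // => exy.
  by rewrite (eqP exy) eqSn_mod => ->.
by rewrite -(eqP exy) eqSn_mod => ->.
Qed.

Lemma sign_ok_dyckl b b' A D : dyck D -> pairwise sign_ok D ->
  all (sign_ok^~ (b, A)) D -> all (sign_ok^~ (b', A)) D.
Proof.
move=> dD pD /allP h; apply/allP=> -[s [r c]] xD.
have [[s' [r' c']] yD /= [es exy]] := dyck_partner dD pD xD.
move: exy yD; rewrite {s'}es => exy yD.
have := h _ xD; have := h _ yD; rewrite /sign_ok /=.
case: s b b' exy {h xD yD} => [] [] [] //=; rewrite ?addn0 ?addn1 // => exy.
  by rewrite (eqP exy) => ->.
by rewrite (eqP exy) => ->.
Qed.

(** All deleted letters at once; they form a bracket word again, so a survivor can be compared with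
    all later ones together. *)
Definition dyck_letters (sk : seq (seq (bool * node) * node)) E :=
  flatten (unzip1 sk) ++ E.

Lemma dyck_letters_dyck sk E : dycks sk -> dyck E -> dyck (dyck_letters sk E).
Proof.
move=> + dE; elim: sk => [|[D A] sk IH] //= [dD /IH].
by rewrite /dyck_letters /= -catA; apply: dyck_cat.
Qed.

Lemma all_fill P n sk E :
  all P (fill n sk E) = all P (signs n (unzip2 sk)) && all P (dyck_letters sk E).
Proof.
elim: sk n => [|[D A] sk IH] n //=.
rewrite /dyck_letters /= !all_cat /= IH /dyck_letters all_cat.
by do !case: (all _ _) => //=; case: (P _).
Qed.

Lemma signs_subseq n sk E : subseq (signs n (unzip2 sk)) (fill n sk E).
Proof.
elim: sk n => [|[D A] sk IH] n /=; first exact: sub0seq.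
by rewrite -cat1s -[_ :: fill _ _ _]cat1s; apply: (@cat_subseq _ [::]) => //;
  rewrite ?sub0seq //= eqxx.
Qed.

Lemma dyck_letters_subseq n sk E : subseq (dyck_letters sk E) (fill n sk E).
Proof.
elim: sk n => [|[D A] sk IH] n //=.
rewrite /dyck_letters /= -catA; apply: cat_subseq => //.
exact: subseq_trans (IH n.-1) (subseq_cons _ _).
Qed.

Lemma all_signs P n w : n <= size w ->
  all P (signs n w) = all (fun A => P (true, A)) (take n w)
                      && all (fun A => P (false, A)) (drop n w).
Proof.
elim: w n => [|A w IH] [|n] //= le; last by rewrite IH // andbA.
by rewrite IH // take0 drop0.
Qed.

Lemma pairwise_signs n w : n <= size w ->
  pairwise sign_ok (signs n w) =
  allrel (fun A B => A.2 == B.2 %[mod d]) (take n w) (drop n w).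
Proof.
elim: w n => [|A w IH] [|n] //= le.
  rewrite IH // all_signs // take0 drop0 allrel0l andbT.
  by rewrite all_predT.
rewrite allrel_consl IH // all_signs //; congr (_ && _).
rewrite (eq_all (a2 := predT)) // all_predT /=.
by apply: eq_all => B; rewrite /sign_ok /= addn0.
Qed.

(* When both signs occur, a first + and a last - force all the columns to be
   congruent. *)
Lemma pairwise_signs_flip n w : n <= size w ->
  pairwise sign_ok (signs n w) -> pairwise sign_ok (signs (size w - n) w).
Proof.
move=> le; rewrite !pairwise_signs ?leq_subr // => /allrelP h.
apply/allrelP => A B At Bd.
(* If only one sign occurs, the same holds after the reflection and there is nothing to compare. *)
case: n le h At Bd => [|n] le h At Bd.
  by rewrite subn0 drop_size in Bd.
case: (ltngtP n.+1 (size w)) => [lt|gt|eq]; last 2 first.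
- by rewrite ltnNge le in gt.
- by rewrite -eq subnn take0 in At.
have ht : nth A w 0 \in take n.+1 w by case: w lt {le h At Bd} => [|C w] // _; apply: mem_head.
have hd : last A w \in drop n.+1 w.
  rewrite -[in last A w](cat_take_drop n.+1 w) last_cat.
  by case: (drop _ _) (size_drop n.+1 w) => [|C s _ /=]; [move=> /=; lia | rewrite mem_last].
have const C : C \in w -> C.2 == (last A w).2 %[mod d].
  rewrite -[in C \in w](cat_take_drop n.+1 w) mem_cat => /orP [Ct|Cd]; first exact: h.
  by rewrite -(eqP (h _ _ ht Cd)); apply: h.
by rewrite (eqP (const _ (mem_take At))) eq_sym (const _ (mem_drop Bd)).
Qed.

(** Pairs of deleted letters do not change, mixed pairs do not see the sign of the survivor, and
    pairs of survivors are assumed. *)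
Lemma pairwise_fill n m sk E : dycks sk -> dyck E ->
    pairwise sign_ok (fill n sk E) -> pairwise sign_ok (signs m (unzip2 sk)) ->
  pairwise sign_ok (fill m sk E).
Proof.
move=> + dE; elim: sk n m => [|[D A] sk IH] n m //= [dD dsk].
rewrite !pairwise_cat /= => /and4P [aD pD an pn] /andP [am pm].
have pdl := subseq_pairwise (dyck_letters_subseq n.-1 sk E) pn.
have dl := dyck_letters_dyck dsk dE.
move: an; rewrite all_fill => /andP [an_s an_l].
have flip b b' B : all (sign_ok^~ (b, B)) D -> all (sign_ok^~ (b', B)) D.
  exact: sign_ok_dyckl.
rewrite pD all_fill am (sign_ok_dyckr (0 < m) dl pdl an_l) /= (IH n.-1) // !andbT.
move: aD; rewrite !(allrelC sign_ok) /allrel /= => /andP [/flip -> /=].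
rewrite !all_fill => /andP [h ->]; rewrite andbT.
(* The letters of [D] precede every later survivor; the survivors are flipped one at a time. *)
elim: (unzip2 sk) (n.-1) (m.-1) h {IH an_s am pm pn pdl} => [|B w IHw] n' m' //=.
by case/andP => /flip -> /IHw ->.
Qed.

Lemma pairwise_fill_reflect n sk E : n <= size sk -> dycks sk -> dyck E ->
  pairwise sign_ok (fill n sk E) -> pairwise sign_ok (fill (size sk - n) sk E).
Proof.
move=> le dsk dE p; apply: (pairwise_fill dsk dE p).
have sw : size (unzip2 sk) = size sk by rewrite size_map.
rewrite -sw; apply: pairwise_signs_flip; rewrite ?sw //.
exact: subseq_pairwise (signs_subseq _ _ _) p.
Qed.

End SignCondition.

(** * Beads and gaps *)

Section Rim.
Implicit Types (la mu : intpart) (A B : node) (z : int).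

Definition content A : int := (Posz A.2 - Posz A.1)%R.

Lemma row_le la r r' : 0 < r -> r <= r' -> rowlen la r' <= rowlen la r.
Proof.
move=> r0 /subnK <-; elim: (r' - r) => [|k IH] //.
by apply: leq_trans IH; rewrite addSn row_leS // addn_gt0 r0 orbT.
Qed.

Lemma rowlen_oversize la r : size la < r -> rowlen la r = 0.
Proof. by case: r => // r; apply: nth_default. Qed.

(* The nodes of the rim path: one per content z, sitting at the end of its row
   if z is a bead (a vertical step) and just below its column if z is a gap (a
   horizontal step). A bead may lie in column 0. *)
Definition rim la A :=
  [&& 0 < A.1, rowlen la A.1 <= A.2 & (A.1 == 1) || (A.2 <= rowlen la A.1.-1)].

Lemma rim_exists la z : exists A, rim la A && (content A == z).
Proof.
(* The row sought is the first with [rowlen la r - r <= z]; a row far below the diagram shows that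
   one exists. *)
have ex : exists r, (0 < r) && (Posz (rowlen la r) <= z + Posz r)%R.
  by exists (size la + `|z|).+1; rewrite rowlen_oversize; lia.
case: (ex_minnP ex) => r /andP [r0 le] rmin.
exists (r, absz (z + Posz r)%R); rewrite /rim /content /=.
have : ~~ ((0 < r.-1) && (Posz (rowlen la r.-1) <= z + Posz r.-1)%R).
  by apply/negP => /rmin; lia.
by case: (r =P 1) => r1 /=; lia.
Qed.

Definition rim_node la z : node := xchoose (rim_exists la z).

Lemma rim_nodeP la z : rim la (rim_node la z).
Proof. by have /andP [] := xchooseP (rim_exists la z). Qed.

Lemma content_rim la z : content (rim_node la z) = z.
Proof. by have /andP [_ /eqP] := xchooseP (rim_exists la z). Qed.

Lemma rim_inj la A B : rim la A -> rim la B -> content A = content B -> A = B.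
Proof.
wlog le : A B / A.1 <= B.1.
  by move=> h rA rB eq; case: (leqP A.1 B.1) => [|/ltnW] le; [|symmetry]; apply: h.
case: A B le => r c [r' c']; rewrite /rim /content /= => le /and3P [r0 h1 h2].
move=> /and3P [r0' h1' h2'] eq.
case: (r =P r') eq => [<-|ne] eq; first by have -> : c = c' by lia.
have /(row_le la r0) : r <= r'.-1 by lia.
by lia.
Qed.

Lemma rim_nodeE la A z : rim la A -> content A = z -> rim_node la z = A.
Proof.
by move=> rA eq; apply: (rim_inj (rim_nodeP la z) rA); rewrite content_rim.
Qed.

Definition rim_col la z : nat := (rim_node la z).2.
Definition bead la z : bool := rim_col la z == rowlen la (rim_node la z).1.

(** One step back along the rim leads down at a bead and left at a gap; the column of a gap is
    positive, so [.-1] does not truncate. *)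
Lemma rim_pred la z : rim_node la (z - 1)%R =
  if bead la z then ((rim_node la z).1.+1, rim_col la z)
  else ((rim_node la z).1, (rim_col la z).-1).
Proof.
rewrite /bead /rim_col; have := content_rim la z; have := rim_nodeP la z.
case: (rim_node la z) => r c; rewrite /rim /content /= => /and3P [r0 h1 h2] eq.
have := @row_leS la r r0.
by case: (c =P rowlen la r) => ne le; apply: rim_nodeE; rewrite /rim /content /=; lia.
Qed.

Lemma rim_col_pred la z : rim_col la z = rim_col la (z - 1)%R + ~~ bead la z.
Proof.
rewrite {2}/rim_col rim_pred; case: ifP => b /=; rewrite ?addn0 //.
by have /and3P [] := rim_nodeP la z; move: b; rewrite /bead /rim_col; lia.
Qed.

Lemma bead_rim la r : 0 < r -> rim la (r, rowlen la r).
Proof.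
by move=> r0; rewrite /rim r0 leqnn /=; case: (r =P 1) => //= ?; apply: row_le; lia.
Qed.

Lemma leq_collen la r c : 0 < r -> 0 < c -> (r <= collen la c) = (c <= rowlen la r).
Proof.
case: r => // r _ c0; rewrite /collen /rowlen /= -[count _ _]addn0 {1}addn0.
have : sorted geq la by case: la => s /= /andP [].
elim: (parts la) r => [|x s IH] r /=; first by rewrite nth_nil; lia.
move=> pth; have srt := path_sorted pth.
case: r => [|r] /=; last first.
  rewrite -IH //; case: (leqP c x) => // lt; rewrite add0n.
  have : count (leq c) s = 0.
    apply/eqP; rewrite -leqn0 leqNgt -has_count; apply/hasPn => y ys.
    have /allP/(_ y ys) := order_path_min (rev_trans leq_trans) pth.
    by rewrite /=; lia.
  by move=> ->; lia.
case: (leqP c x) => //= lt; rewrite add0n.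
apply/negbTE; rewrite -has_count; apply/hasPn => y ys.
have /allP/(_ y ys) := order_path_min (rev_trans leq_trans) pth.
by rewrite /=; lia.
Qed.

Lemma balancedP (d e : nat) la :
  d_balanced d e la <->
  forall z z', (z < z')%R -> (e %| (z' - z)%R)%Z -> ~~ bead la z -> bead la z' ->
    rim_col la z == rim_col la z' %[mod d].
Proof.
split=> [bal z z' lt ez|bal [r c]].
  rewrite /bead /rim_col; have := content_rim la z; have := rim_nodeP la z.
  have := content_rim la z'; have := rim_nodeP la z'.
  case: (rim_node la z) => r c; case: (rim_node la z') => r' c'.
  rewrite /rim /content /= => /and3P [r0' h1' h2'] eq' /and3P [r0 h1 h2] eq gap.
  move=> /eqP ec'; move: h1' h2' eq'; rewrite {c'}ec' => h1' h2' eq'.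
  (* A bead in row [r] or below has content less than [z]. *)
  have rr : r' < r.
    by rewrite ltnNge; apply/negP => rr; have := row_le la r0 rr; lia.
  have le := @row_le la r' r.-1 r0'.
  (* The gap lies just below the last node of column [c]. *)
  have cl : collen la c = r.-1.
    have := @leq_collen la r c; have := @leq_collen la r.-1 c.
    by lia.
  have := bal (r', c); rewrite /young /hook_length /arm /leg inE /= cl.
  rewrite eq_sym eqn_mod_dvd; last by lia.
  by apply; [lia | move: ez; rewrite dvdzE; congr (_ %| _); lia].
rewrite /young /hook_length /arm /leg inE /= => /and3P [r0 c0 le] eh.
have rc := @leq_collen la r c r0 c0.
have rcS := @leq_collen la (collen la c).+1 c isT c0.
have rcl := @leq_collen la (collen la c) c.
have rb := bead_rim la r0.
have rg : rim la ((collen la c).+1, c) by rewrite /rim /=; lia.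
rewrite -eqn_mod_dvd // eq_sym.
(* The hook of [(r, c)] corresponds to the gap below column [c] and the bead ending row [r]. *)
have := bal (content ((collen la c).+1, c)) (content (r, rowlen la r)).
rewrite /bead /rim_col !(rim_nodeE rg erefl) !(rim_nodeE rb erefl) /= eqxx => h.
apply: h => //; rewrite /content /=; try lia.
by move: eh; rewrite dvdzE; congr (_ %| _); lia.
Qed.

(* Stated through row lengths, so that it also describes the removal of A from
   mu without identifying mu with a value of [add_node]. *)
Definition adds la A mu :=
  addable la A /\ forall r, 0 < r -> rowlen mu r = (A.1 == r) + rowlen la r.

Lemma adds_add la A : addable la A -> adds la A (add_node la A).
Proof. by move=> aA; split=> // r r0; apply: row_add. Qed.

Lemma rem_adds la A : removable la A -> adds (rem_node la A) A la.
Proof.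
move=> rA; have row := row_rem rA; case/and4P: (rA) => r0 c0 /eqP ec lt; split.
  rewrite /addable r0 row // eqxx; case: (A.1 =P 1) => [e1|ne] /=; first by lia.
  have r1 : 0 < A.1.-1 by lia.
  have := row_leS la r1; rewrite row // prednK //.
  by have -> : (A.1 == A.1.-1) = false; lia.
by move=> r ltr; rewrite row //; case: eqP => [<-|_]; lia.
Qed.

(** * Effect of one added node on beads, gaps and rim nodes *)

Section Adds.
Variables (la mu : intpart) (A : node).
Hypothesis ad : adds la A mu.

Let A1 : 0 < A.1. Proof. by case: ad => /and3P []. Qed.
Let A2 : A.2 = (rowlen la A.1).+1. Proof. by case: ad => /and3P [_ /eqP]. Qed.
Let A3 : A.1 != 1 -> rowlen la A.1 < rowlen la A.1.-1.
Proof. by case: ad => /and3P [_ _ /orP [->|]]. Qed.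

Lemma adds_removable : removable mu A.
Proof.
case: ad => _ row; have := @row_leS la A.1 A1.
by rewrite /removable !row //; lia.
Qed.

Lemma adds_rim_node z : z <> content A -> z <> (content A - 1)%R ->
  rim_node mu z = rim_node la z.
Proof.
move=> ne ne'; apply: rim_nodeE (content_rim la z).
have := content_rim la z; have := rim_nodeP la z.
case: (rim_node la z) => r c; rewrite /rim /content /= in ne ne' *.
case: ad => _ row /and3P [r0 h1 h2] eq; rewrite r0 row //=.
apply/andP; split; first by case: (A.1 =P r) h1 => [er|_]; rewrite -?er; lia.
by case: (r =P 1) h2 => //= r1 h2; rewrite row; lia.
Qed.

Lemma adds_bead z : z <> content A -> z <> (content A - 1)%R ->
  bead mu z = bead la z.
Proof.
move=> ne ne'; rewrite /bead /rim_col adds_rim_node //.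
have := content_rim la z; have := rim_nodeP la z.
case: (rim_node la z) => r c; rewrite /rim /content /= in ne ne' *.
case: ad => _ row /and3P [r0 h1 h2] eq; rewrite row //.
by case: (A.1 =P r) h1 => [er|_]; rewrite -?er; lia.
Qed.

(** Before the addition [A] ends a horizontal step, afterwards a vertical one; the rim node moves at
    content [content A - 1] only. *)
Lemma rim_node_adds : rim_node la (content A) = A /\ rim_node mu (content A) = A.
Proof.
split; apply: rim_nodeE => //; case: ad => _ row; rewrite /rim A1 /=.
  by case: eqP A3 => //= ? h; lia.
rewrite row // eqxx; case: eqP A3 => //= ? h; rewrite ?row; lia.
Qed.

Lemma bead_adds :
  [/\ bead la (content A) = false, bead la (content A - 1)%R,
      bead mu (content A) & bead mu (content A - 1)%R = false].
Proof.
have [eqla eqmu] := rim_node_adds; case: ad => _ row.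
have b : bead la (content A) = false by rewrite /bead /rim_col eqla; lia.
have b' : bead mu (content A) by rewrite /bead /rim_col eqmu row //; lia.
split=> //; rewrite /bead {1}/rim_col rim_pred ?b ?b' /= /rim_col ?eqla ?eqmu ?row //; first lia.
have := @row_leS la A.1 A1; rewrite /=; lia.
Qed.

End Adds.

End Rim.

(** * Signatures and reflections *)

Lemma rev_iotaS n : rev (iota 1 n.+1) = n.+1 :: rev (iota 1 n).
Proof. by rewrite -[n.+1]addn1 iotaD rev_cat addn1. Qed.

Section RowLists.

(** * Signatures read row by row *)

Variables (T : eqType) (R : rel T) (F : nat -> seq T).

Lemma pairwise_rows n : (forall r, size (F r) <= 1) ->
  reflect (forall r r' a b, 0 < r' -> r' < r -> r <= n ->
             a \in F r -> b \in F r' -> R a b)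
          (pairwise R (flatten [seq F r | r <- rev (iota 1 n)])).
Proof.
move=> sF; elim: n => [|n IH].
  by apply: (iffP idP) => // _ r r' a b; lia.
rewrite rev_iotaS /= pairwise_cat.
have -> : pairwise R (F n.+1) by case: (F n.+1) (sF n.+1) => [|a []].
apply: (iffP andP) => [[/allrelP h /IH{}IH] r r' a b r0 lt le ar br|h].
  case: (ltngtP r n.+1) => [ltr|gtr|er]; [exact: (IH r r')|lia|].
  apply: h; first by rewrite -er.
  by apply/flatten_mapP; exists r' => //; rewrite mem_rev mem_iota; lia.
split; last by apply/IH => r r' a b r0 lt le; apply: h; lia.
apply/allrelP => a b an /flatten_mapP [r']; rewrite mem_rev mem_iota => lt br.
by apply: (h n.+1 r') => //; lia.
Qed.

End RowLists.

Lemma shift_pred (u v : int) : (v - 1 - (u - 1) = v - u)%R.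
Proof. by lia. Qed.

Lemma shift_succ (u v : int) : (v + 1 - (u + 1) = v - u)%R.
Proof. by lia. Qed.

Lemma succ_pred (u : int) : (u + 1 - 1 = u)%R.
Proof. by lia. Qed.

Section Signature.
Variables d e i : nat.
Hypothesis e_gt1 : 1 < e.
Implicit Types (la mu nu : intpart) (A B : node) (z : int).

Definition level z := modz z (Posz e) == Posz i.

Lemma level_dvd z z' : (Posz e %| (z' - z)%R)%Z -> level z' = level z.
Proof. by rewrite -eqz_mod_dvd /level => /eqP ->. Qed.

Lemma level_congr z z' : level z -> level z' -> (Posz e %| (z' - z)%R)%Z.
Proof. by rewrite -eqz_mod_dvd /level => /eqP -> /eqP ->. Qed.

(** Since [e > 1], the pairs [(z - 1, z)] with [level z] are disjoint. *)
Lemma levelS z : level z -> level (z + 1)%R = false.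
Proof.
move=> lz; apply/negP => /(level_congr lz); rewrite dvdzE.
have -> : absz (z + 1 - z)%R = 1 by lia.
by rewrite dvdn1 /=; lia.
Qed.

Definition row_signature la r : seq (bool * node) :=
  [seq (false, A) | A <- [:: (r, rowlen la r)]
                  & removable la A && (residue e A == Posz i)] ++
  [seq (true, A) | A <- [:: (r, (rowlen la r).+1)]
                 & addable la A && (residue e A == Posz i)].

Lemma mem_row_signature la r b A : ((b, A) \in row_signature la r) =
  [&& A.1 == r, level (content A) & if b then addable la A else removable la A].
Proof.
rewrite /row_signature mem_cat; apply/orP/and3P.
  by case=> /mapP [B]; rewrite mem_filter inE => /andP [/andP [h lB] /eqP eB] [-> ->];
     rewrite eB /= in h lB *.
case=> /eqP <- lA; case: b => h; [right|left]; apply/mapP; exists A => //;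
  rewrite mem_filter h -[residue e A == _]/(level (content A)) lA inE.
  by case/and3P: h => _ /eqP <- _; rewrite -surjective_pairing eqxx.
by case/and4P: h => _ _ /eqP <- _; rewrite -surjective_pairing eqxx.
Qed.

(** The last node of a row and the node after it have consecutive contents, hence not both residue
    [i]. *)
Lemma size_row_signature la r : size (row_signature la r) <= 1.
Proof.
rewrite /row_signature size_cat !size_map !size_filter /= !addn0.
case: andP => [[_ lr]|_]; case: andP => [[_ lr']|_] //.
have := @levelS (content (r, rowlen la r)) lr.
have -> : (content (r, rowlen la r) + 1)%R = content (r, (rowlen la r).+1).
  by rewrite /content /=; lia.
by rewrite [level _]lr'.
Qed.

(** The free bound [n] allows partitions with different numbers of rows to be compared over the same
    rows. *)
Lemma signatureE la n : size la < n ->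
  signature e i la = flatten [seq row_signature la r | r <- rev (iota 1 n)].
Proof.
move=> /subnK <-; elim: (n - _) => [|k ->] //.
rewrite addSn rev_iotaS /=.
suff -> : row_signature la (k + (size la).+1).+1 = [::] by [].
apply/nilP; rewrite /nilp -leqn0 leqNgt; apply/negP.
rewrite -has_predT => /hasP [[b A]]; rewrite mem_row_signature => /and3P [/eqP er _ h] _.
move: h; rewrite /addable /removable er /= !(@rowlen_oversize la); try lia.
by case: b; rewrite ?andbF; lia.
Qed.

Lemma signature_pairwise (R : rel (bool * node)) la :
  reflect (forall a b, a \in row_signature la a.2.1 ->
             b \in row_signature la b.2.1 -> b.2.1 < a.2.1 -> R a b)
          (pairwise R (signature e i la)).
Proof.
rewrite (signatureE (ltnSn _)).
have pos a r : a \in row_signature la r -> [/\ a.2.1 = r, 0 < r & r <= (size la).+1].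
  case: a => b A; rewrite mem_row_signature => /and3P [/eqP <- _ h] /=; split=> //.
    by case: b h => [/and3P []|/and4P []].
  rewrite leqNgt; apply/negP => lt; move: h.
  rewrite /addable /removable !(@rowlen_oversize la); try lia.
  by case: b; rewrite ?andbF; lia.
apply: (iffP (pairwise_rows _ _ (size_row_signature la))) => h.
  move=> a b aa bb lt; have [_ _ le] := pos _ _ aa; have [_ r0 _] := pos _ _ bb.
  exact: (h a.2.1 b.2.1).
move=> r r' a b _ lt _ aa bb; have [ea _ _] := pos _ _ aa; have [eb _ _] := pos _ _ bb.
by apply: h; rewrite ?ea ?eb.
Qed.

Lemma signature_uniq la : uniq (unzip2 (signature e i la)).
Proof.
rewrite uniq_pairwise pairwise_map; apply/signature_pairwise => a b _ _ /= lt.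
by apply: contraTneq lt => ->; rewrite ltnn.
Qed.

Lemma eq_seq_size1 (T : eqType) (s t : seq T) :
  size s <= 1 -> size t <= 1 -> s =i t -> s = t.
Proof.
case: s t => [|x [|//]] [|y [|//]] // _ _ h.
- by have := h y; rewrite !inE eqxx.
- by have := h x; rewrite !inE eqxx.
- by have := h x; rewrite !inE eqxx => /esym/eqP ->.
Qed.

Section Adds.
Variables (la mu : intpart) (A : node).
Hypotheses (ad : adds la A mu) (lA : level (content A)).

Lemma row_signature_adds r : 0 < r ->
  if r == A.1 then row_signature la r = [:: (true, A)] /\
                   row_signature mu r = [:: (false, A)]
  else row_signature mu r = row_signature la r.
Proof.
move=> r0; case: eqP => [->|ne].
  have inla : (true, A) \in row_signature la A.1.
    by rewrite mem_row_signature eqxx lA; case: ad.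
  have inmu : (false, A) \in row_signature mu A.1.
    by rewrite mem_row_signature eqxx lA (adds_removable ad).
  move: inla inmu (size_row_signature la A.1) (size_row_signature mu A.1).
  case: (row_signature la _) => [|x [|//]] //; case: (row_signature mu _) => [|y [|//]] //.
  by rewrite !inE => /eqP <- /eqP <-.
apply: eq_seq_size1 (size_row_signature _ _) (size_row_signature _ _) _ => -[b [s c]].
rewrite !mem_row_signature /=; case: eqP => //= er; case: (boolP (level _)) => //= lB.
(* Outside the row of [A], only nodes of content adjacent to that of [A] can become or cease to be
   addable or removable, and these have another residue. *)
have ne1 : content (s, c) <> (content A + 1)%R by move=> eq; have := lB; rewrite eq levelS.
have ne2 : content A <> (content (s, c) + 1)%R by move=> eq; have := lA; rewrite eq levelS.
have [/and3P [A1 /eqP A2 _] row] := ad.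
rewrite /content /= in ne1 ne2; case: b; rewrite /addable /removable /=.
  have -> : rowlen mu s = rowlen la s by rewrite row; lia.
  case: (s =P 1) => //= B1; rewrite row; last by lia.
  by case: (A.1 =P s.-1) => [eA|//]; rewrite -eA in ne1 ne2 *; lia.
have -> : rowlen mu s = rowlen la s by rewrite row; lia.
rewrite row; last by lia.
by case: (A.1 =P s.+1) => [eA|//]; rewrite -eA in ne1 ne2 *; lia.
Qed.

Lemma signature_adds :
  signature e i mu = map (set_sign false A) (signature e i la) /\
  signature e i la = map (set_sign true A) (signature e i mu).
Proof.
have le1 : size la < (maxn (size la) (size mu)).+1 by lia.
have le2 : size mu < (maxn (size la) (size mu)).+1 by lia.
rewrite (signatureE le1) (signatureE le2) !map_flatten -!map_comp.
have same b r : r <> A.1 -> map (set_sign b A) (row_signature la r) = row_signature la r.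
  move=> ne; rewrite set_sign_id //; apply/mapP => -[[b' B]].
  by rewrite mem_row_signature => /and3P [/eqP er _ _] /= eA; case: ne; rewrite eA er.
split; congr flatten; apply/eq_in_map => r; rewrite mem_rev mem_iota /= => /andP [r0 _].
  have := row_signature_adds r0; case: eqP => [_ [-> ->]|ne ->]; last by rewrite same.
  by rewrite /= /set_sign eqxx.
have := row_signature_adds r0; case: eqP => [_ [-> ->]|ne ->]; last by rewrite same.
by rewrite /= /set_sign eqxx.
Qed.

End Adds.

(** Records exchanges of a bead and a gap inside pairs [(z - 1, z)] with [level z]: these alter the
    rim column at the lower position only and keep the number of beads of the pair. *)
Definition same_levels la mu := forall z,
  [/\ ~~ level (z + 1)%R -> rim_col la z = rim_col mu z,
      ~~ level z -> ~~ level (z + 1)%R -> bead la z = bead mu z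
    & level z -> bead la (z - 1)%R + bead la z = bead mu (z - 1)%R + bead mu z].

Lemma same_levels_sym la mu : same_levels la mu -> same_levels mu la.
Proof.
move=> h z; have [h1 h2 h3] := h z.
by split=> [l|l l'|l]; [rewrite h1|rewrite h2|rewrite h3].
Qed.

Lemma same_levels_trans la mu nu :
  same_levels la mu -> same_levels mu nu -> same_levels la nu.
Proof.
move=> h k z; have [h1 h2 h3] := h z; have [k1 k2 k3] := k z.
by split=> [l|l l'|l]; [rewrite h1 ?k1|rewrite h2 ?k2|rewrite h3 ?k3].
Qed.

Lemma same_levels_adds la A mu :
  adds la A mu -> level (content A) -> same_levels la mu.
Proof.
move=> ad lA z; have [rla rmu] := rim_node_adds ad.
have [b1 b2 b3 b4] := bead_adds ad.
case: (z =P content A) => [->|ne].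
  by rewrite lA; split=> // _; [rewrite /rim_col rla rmu|rewrite b1 b2 b3 b4].
case: (z =P (content A - 1)%R) => [->|ne'].
  have eq : (content A - 1 + 1)%R = content A by lia.
  by rewrite eq lA; split=> // lz; have := levelS lz; rewrite eq lA.
split=> [_|_ _|lz].
- by rewrite /rim_col (adds_rim_node ad).
- by rewrite (adds_bead ad).
rewrite !(adds_bead ad) //; last by lia.
move=> eq; have := levelS lA; suff -> : (content A + 1)%R = z by rewrite lz.
by lia.
Qed.

(** * Signs as pairs of one bead and one gap, + having its bead at the lower position *)

Lemma signature_bead la b A : (b, A) \in row_signature la A.1 ->
  [/\ level (content A), rim_node la (content A) = A,
      bead la (content A) = ~~ b & bead la (content A - 1)%R = b].
Proof.
rewrite mem_row_signature eqxx => /and3P [_ lA]; case: b => [/adds_add|/rem_adds] ad;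
  by have [b1 b2 b3 b4] := bead_adds ad; have [r1 r2] := rim_node_adds ad.
Qed.

Lemma bead_signature la z : level z -> bead la (z - 1)%R != bead la z ->
  (bead la (z - 1)%R, rim_node la z) \in row_signature la (rim_node la z).1.
Proof.
move=> lz; rewrite mem_row_signature eqxx content_rim lz /=.
have := rim_nodeP la z; have := content_rim la z.
rewrite [bead la (z - 1)%R]/bead /rim_col rim_pred /bead /rim_col.
case: (rim_node la z) => r c; rewrite /content /rim /addable /removable /=.
move=> eq /and3P [r0 h1 h2]; case: (c =P rowlen la r) => ec /=.
  by have := row_leS la r0; case: (c =P rowlen la r.+1) => //= ne le _; lia.
by case: (c.-1 =P rowlen la r) => //= ec' _; lia.
Qed.

Lemma rim_content_lt la A B : rim la A -> rim la B -> B.1 < A.1 ->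
  (content A < content B)%R.
Proof.
case: A B => r c [r' c']; rewrite /rim /content /= => /and3P [r0 h1 h2].
move=> /and3P [r0' h1' h2'] lt.
by have := @row_le la r' r.-1 r0'; lia.
Qed.

Lemma balanced_signature la :
  d_balanced d e la -> pairwise (sign_ok d) (signature e i la).
Proof.
move=> /balancedP bal; apply/(signature_pairwise _ _) => -[b A] [b' B] /=.
move=> /signature_bead [lA rA bA bA'] /signature_bead [lB rB bB bB'] lt.
have rimA : rim la A by rewrite -rA; apply: rim_nodeP.
have rimB : rim la B by rewrite -rB; apply: rim_nodeP.
have ltz := rim_content_lt rimA rimB lt.
have ez := level_congr lA lB.
rewrite /sign_ok /=; apply/implyP; have cA := rim_col_pred la (content A).
have cB := rim_col_pred la (content B); have := bal _ _ ltz ez.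
(* A + before a - compares the upper positions of the two pairs, a - before a + the lower ones. *)
have := bal (content A - 1)%R (content B - 1)%R.
rewrite /rim_col rA rB in cA cB *; rewrite bA bA' bB bB' in cA cB *.
rewrite shift_pred.
case: b b' {bA bA' bB bB'} cA cB => [] [] //= cA cB h1 h2 _.
  by rewrite addn0; apply: h2.
by rewrite cA cB addn0 eqn_modDr; apply: h1 => //; rewrite Num.Theory.ltrD2r.
Qed.

(** Compares two pairs with columns [a] and [b] at the upper positions. The lower columns are
    [a - ~~ y] and [b - ~~ v]; moving these terms across avoids truncated subtraction. *)
Definition level_pair_ok (a b : nat) (x y w v : bool) :=
  (~~ y ==> v ==> (a == b %[mod d]))
  && (~~ x ==> w ==> (a + ~~ v == b + ~~ y %[mod d])).

(* The two conditions on a pair of levels with at most one sign do not see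
   which sign it is. *)
Lemma level_pair_transfer (a b : nat) (x y x' y' w v w' v' : bool) :
    x + y = x' + y' -> w + v = w' + v' -> level_pair_ok a b x y w v ->
    (x' != y' -> w' != v' -> sign_ok d (x', (0, a)) (w', (0, b))) ->
  level_pair_ok a b x' y' w' v'.
Proof.
rewrite /level_pair_ok /sign_ok /=.
case: x y x' y' => [] [] [] [] //= _; case: w v w' v' => [] [] [] [] //= _.
all: rewrite ?addn0 ?addn1 ?eqSn_mod ?andbT //.
all: by move=> h1 h2; rewrite ?h2 ?h1.
Qed.

Lemma level_pair_okE la u v :
  level_pair_ok (rim_col la u) (rim_col la v)
    (bead la (u - 1)%R) (bead la u) (bead la (v - 1)%R) (bead la v) =
  (~~ bead la u ==> bead la v ==> (rim_col la u == rim_col la v %[mod d])) &&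
  (~~ bead la (u - 1)%R ==> bead la (v - 1)%R ==>
    (rim_col la (u - 1)%R == rim_col la (v - 1)%R %[mod d])).
Proof.
rewrite /level_pair_ok [in _ + _]rim_col_pred [X in _ == X + _ %[mod d]]rim_col_pred.
by rewrite -!addnA [X in _ == _ + X %[mod d]]addnC eqn_modDr.
Qed.

Lemma balanced_transfer la mu : same_levels la mu ->
    d_balanced d e la -> pairwise (sign_ok d) (signature e i mu) ->
  d_balanced d e mu.
Proof.
move=> same /balancedP bal /(signature_pairwise _ _) sgn; apply/balancedP.
have key u v : level u -> level v -> (u < v)%R ->
    level_pair_ok (rim_col mu u) (rim_col mu v)
      (bead mu (u - 1)%R) (bead mu u) (bead mu (v - 1)%R) (bead mu v).
  move=> lu lv lt; have [cu _ bu] := same u; have [cv _ bv] := same v.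
  apply: level_pair_transfer (bu lu) (bv lv) _ _.
    rewrite -cu ?levelS // -cv ?levelS // level_pair_okE.
    apply/andP; split; apply/implyP => gu; apply/implyP => gv; apply: bal => //.
    - exact: level_congr lu lv.
    - by rewrite Num.Theory.ltrD2r.
    rewrite shift_pred; exact: level_congr lu lv.
  move=> /(bead_signature lu) su /(bead_signature lv) sv.
  apply: (sgn _ _ su sv) => /=.
  have ru := rim_nodeP mu u; have rv := rim_nodeP mu v.
  have cu' := content_rim mu u; have cv' := content_rim mu v.
  (* Contents grow upwards along the rim, and two signs in one row coincide, which would give
     [u = v]. *)
  case: (ltngtP (rim_node mu v).1 (rim_node mu u).1) => // [gt|eq].
    have := rim_content_lt rv ru gt; rewrite cu' cv'.
    by rewrite Order.POrderTheory.lt_gtF.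
  have := size_row_signature mu (rim_node mu u).1.
  move: sv su; rewrite eq; case: (row_signature _ _) => [|p [|//]] //.
  rewrite !inE => /eqP <- /eqP [_ eqr].
  by move: lt; rewrite -cu' -cv' eqr Order.POrderTheory.ltxx.
move=> z z' lt ez gz gz'.
have [c _ _] := same z; have [c' _ _] := same z'.
(* The position [z] is the upper one of a pair, the lower one, or in no pair, where nothing changed;
   [z'] is in the same case since [e] divides [z' - z]. *)
case l : (level z).
  have l' : level z' by rewrite (level_dvd ez).
  by have /andP [] := key z z' l l' lt; rewrite gz gz'.
case lS : (level (z + 1)%R).
  have ez1 : (Posz e %| (z' + 1 - (z + 1))%R)%Z by rewrite shift_succ.
  have lS' : level (z' + 1)%R by rewrite (level_dvd ez1).
  have := key _ _ lS lS'; rewrite level_pair_okE.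
  rewrite !succ_pred gz gz' Num.Theory.ltrD2r /=.
  by case/(_ lt)/andP.
have l' : level z' = false by rewrite (level_dvd ez).
have ez1 : (Posz e %| (z' + 1 - (z + 1))%R)%Z by rewrite shift_succ.
have lS' : level (z' + 1)%R = false by rewrite (level_dvd ez1).
have [_ b _] := same z; have [_ b' _] := same z'.
rewrite -c ?lS // -c' ?lS' //; apply: bal => //.
  by rewrite b ?l ?lS.
by rewrite b' ?l' ?lS'.
Qed.

Lemma mem_signature la b A : (b, A) \in signature e i la ->
  level (content A) /\ if b then addable la A else removable la A.
Proof.
rewrite (signatureE (ltnSn _)) => /flatten_mapP [r _].
by rewrite mem_row_signature => /and3P [].
Qed.

Lemma mem_plus_nodes la A : A \in plus_nodes e i la -> (true, A) \in reduced_signature e i la.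
Proof. by case/mapP => -[[] B]; rewrite mem_filter //= => xr ->. Qed.

Lemma mem_minus_nodes la A : A \in minus_nodes e i la -> (false, A) \in reduced_signature e i la.
Proof. by case/mapP => -[[] B]; rewrite mem_filter //= => xr ->. Qed.

(** * Crystal operators on a decomposed signature, with the deleted letters kept fixed *)

Section Steps.
Variables (sk : seq (seq (bool * node) * node)) (E : seq (bool * node)).
Hypotheses (dsk : dycks sk) (dE : dyck E).

Lemma plus_nodes_fill la n : signature e i la = fill n sk E ->
  plus_nodes e i la = take n (unzip2 sk).
Proof.
by rewrite /plus_nodes /reduced_signature => ->; rewrite reduce_fill // signs_plus.
Qed.

Lemma minus_nodes_fill la n : signature e i la = fill n sk E ->
  minus_nodes e i la = drop n (unzip2 sk).
Proof.
by rewrite /minus_nodes /reduced_signature => ->; rewrite reduce_fill // signs_minus.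
Qed.

Lemma mem_reduced la n x : signature e i la = fill n sk E ->
  x \in reduced_signature e i la -> x \in signature e i la.
Proof.
rewrite /reduced_signature => ->; rewrite reduce_fill //.
exact/mem_subseq/signs_subseq.
Qed.

Lemma f_tilde_fill la n : n < size sk -> signature e i la = fill n.+1 sk E ->
  signature e i (f_tilde e i la) = fill n sk E /\ same_levels la (f_tilde e i la).
Proof.
(* Among [n.+1] surviving +, the rightmost has index [n]; flipping it lowers the threshold by
   one. *)
move=> lt sig; pose A := nth (0, 0) (unzip2 sk) n.
have plus : plus_nodes e i la = rcons (take n (unzip2 sk)) A.
  by rewrite (plus_nodes_fill sig) (take_nth (0, 0)) ?size_map.
have [lA /adds_add ad] : level (content A) /\ addable la A.
  apply: (@mem_signature la true); apply: (mem_reduced sig).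
  by apply: mem_plus_nodes; rewrite plus mem_rcons inE eqxx.
rewrite /f_tilde plus rev_rcons; split; last exact: same_levels_adds lA.
have [-> _] := signature_adds ad lA.
rewrite sig; apply: set_sign_fill => //; last by lia.
- by rewrite -sig signature_uniq.
- by move=> j; lia.
Qed.

Lemma e_tilde_fill la n : n < size sk -> signature e i la = fill n sk E ->
  signature e i (e_tilde e i la) = fill n.+1 sk E /\ same_levels la (e_tilde e i la).
Proof.
move=> lt sig; pose A := nth (0, 0) (unzip2 sk) n.
have minus : minus_nodes e i la = A :: drop n.+1 (unzip2 sk).
  by rewrite (minus_nodes_fill sig) (drop_nth (0, 0)) ?size_map.
have [lA /rem_adds ad] : level (content A) /\ removable la A.
  apply: (@mem_signature la false); apply: (mem_reduced sig).
  by apply: mem_minus_nodes; rewrite minus inE eqxx.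
rewrite /e_tilde minus; split; last exact/same_levels_sym/(same_levels_adds ad).
have [_ ->] := signature_adds ad lA.
rewrite sig; apply: set_sign_fill => //.
- by rewrite -sig signature_uniq.
- by move=> j; lia.
by rewrite ltnSn.
Qed.

Lemma iter_f_tilde_fill la n k : k <= n -> n <= size sk ->
    signature e i la = fill n sk E ->
  signature e i (iter k (f_tilde e i) la) = fill (n - k) sk E /\
  same_levels la (iter k (f_tilde e i) la).
Proof.
move=> le le' sig; elim: k le => [|k IH] le; first by rewrite subn0.
have [sigk samek] := IH (ltnW le).
have lt : n - k.+1 < size sk by lia.
have [//|sigS sameS] := f_tilde_fill lt (la := iter k (f_tilde e i) la).
  by rewrite sigk subnSK.
by split=> //; apply: same_levels_trans samek sameS.
Qed.

Lemma iter_e_tilde_fill la n k : n + k <= size sk ->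
    signature e i la = fill n sk E ->
  signature e i (iter k (e_tilde e i) la) = fill (n + k) sk E /\
  same_levels la (iter k (e_tilde e i) la).
Proof.
move=> + sig; elim: k => [|k IH] le; first by rewrite addn0.
have lt : n + k < size sk by lia.
have [sigk samek] := IH (ltnW lt); rewrite addnS.
have [sigS sameS] := e_tilde_fill lt sigk.
by split=> //; apply: same_levels_trans samek sameS.
Qed.

(** Here [varphi] is [n] and [vareps] is [size sk - n]; every branch of [sigma] exchanges these two
    numbers. *)
Lemma sigma_fill la n : n <= size sk -> signature e i la = fill n sk E ->
  signature e i (sigma e i la) = fill (size sk - n) sk E /\
  same_levels la (sigma e i la).
Proof.
move=> le sig; rewrite /sigma.
have -> : varphi e i la = n.
  by rewrite /varphi (plus_nodes_fill sig) size_takel ?size_map.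
have -> : vareps e i la = size sk - n.
  by rewrite /vareps (minus_nodes_fill sig) size_drop size_map.
case: ltngtP => [lt|gt|eq].
- have [|sigs same] := @iter_f_tilde_fill la n (n - (size sk - n)) _ le sig.
    exact: leq_subr.
  by split=> //; rewrite sigs; congr fill; lia.
- have [|sigs same] := @iter_e_tilde_fill la n (size sk - n - n) _ sig; first by lia.
  by split=> //; rewrite sigs; congr fill; lia.
by rewrite eq sig.
Qed.

End Steps.
End Signature.

Theorem theorem4p4 (d e : nat) (hd : 1 < d) (he : 1 < e)
    (la : intpart) (hreg : e_regular e la) (hbal : d_balanced d e la)
    (i : nat) (hi : i < e) :
  d_balanced d e (sigma e i la).
Proof.
have [n [sk [E [sig dsk dE le]]]] := fill_exists (signature e i la).
have [sigs same] := sigma_fill he dsk dE le sig.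
apply: (balanced_transfer he same hbal); rewrite sigs.
by apply: pairwise_fill_reflect => //; rewrite -sig; apply: balanced_signature.
Qed.
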